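(* Let $\rho$ be a representation of a compact Lie group $G$. For each connected component $C$ of $G$, the extreme values (maximum and minimum) of $\operatorname{Re}\operatorname{Tr}\rho$ on $C$ are algebraic numbers.
   Context: A representation of $G$ is a continuous homomorphism $G\to\operatorname{GL}_n(\mathbb{C})$ for some $n\ge 1$. The group $G$ need not be connected. Algebraic numbers are complex numbers algebraic over $\mathbb{Q}$. *)

(* Defs.v *)
From HB Require Import structures.
From mathcomp Require Import all_boot all_order all_algebra.
From mathcomp Require Import all_classical all_reals all_analysis.
From mathcomp Require Export complex.

Set Implicit Arguments.
Unset Strict Implicit.
Unset Printing Implicit Defensive.

Import Order.TTheory GRing.Theory Num.Theory.
Import numFieldNormedType.Exports.

Local Open Scope classical_set_scope.
Local Open Scope ring_scope.

(* The usual topology of R[i], given by its modulus. *)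
HB.instance Definition _ (R : rcfType) :=
  NormedModule.copy R[i] (R[i] : numFieldType)^o.

(* A type with a group law and a topology; their compatibility is part of
   [lie_group] below. *)
#[short(type="topGroupType")]
HB.structure Definition TopGroup := {G of Topological G & Group G}.

Section Smoothness.
Context {R : realType} {m n : nat}.
Implicit Types (W : set 'rV[R]_m) (f : 'rV[R]_m -> 'rV[R]_n).

(* f is C^k on W: its iterated partial derivatives up to order k exist and are
   continuous on W. It is meant for open W. *)
Fixpoint Ck_on (k : nat) W f : Prop :=
  (forall x, W x -> {for x, continuous f}) /\
  if k is k'.+1 then
    forall j : 'I_m,
      (forall x, W x -> derivable f x (delta_mx 0 j)) /\
      Ck_on k' W (fun x => 'D_(delta_mx 0 j) f x)
  else True.

Definition smooth_on W f : Prop := forall k, Ck_on k W f.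

End Smoothness.

Section Manifolds.
Context {R : realType}.

(* [chart_fun] matters on [chart_dom] only, [chart_inv] on [chart_img] only. *)
Record chart (T : Type) (d : nat) := Chart {
  chart_dom : set T;
  chart_fun : T -> 'rV[R]_d;
  chart_inv : 'rV[R]_d -> T
}.

Definition chart_img T d (a : chart T d) : set 'rV[R]_d :=
  chart_fun a @` chart_dom a.

Definition is_chart (T : topologicalType) d (a : chart T d) : Prop :=
  [/\ open (chart_dom a),
      open (chart_img a),
      forall x, chart_dom a x -> chart_inv a (chart_fun a x) = x,
      forall x, chart_dom a x -> {for x, continuous (chart_fun a)} &
      forall v, chart_img a v -> {for v, continuous (chart_inv a)}].

(* The expression of f in the charts a and b is smooth where it is defined. *)
Definition smooth_in_charts T1 T2 d1 d2 (a : chart T1 d1) (b : chart T2 d2)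
    (f : T1 -> T2) : Prop :=
  smooth_on
    [set v | chart_img a v /\ chart_dom b (f (chart_inv a v))]
    (fun v => chart_fun b (f (chart_inv a v))).

Definition is_smooth_atlas (T : topologicalType) d (A : set (chart T d)) : Prop :=
  [/\ forall a, A a -> is_chart a,
      forall x, exists2 a, A a & chart_dom a x &
      forall a b, A a -> A b -> smooth_in_charts a b id].

Definition is_manifold (T : topologicalType) d (A : set (chart T d)) : Prop :=
  [/\ hausdorff_space T, @second_countable T & is_smooth_atlas A].

Definition smooth_map (T1 T2 : topologicalType) d1 d2
    (A : set (chart T1 d1)) (B : set (chart T2 d2)) (f : T1 -> T2) : Prop :=
  continuous f /\ forall a b, A a -> B b -> smooth_in_charts a b f.

Definition prod_chart T1 T2 d1 d2 (a : chart T1 d1) (b : chart T2 d2) :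
    chart (T1 * T2) (d1 + d2) :=
  Chart (chart_dom a `*` chart_dom b)
    (fun p => row_mx (chart_fun a p.1) (chart_fun b p.2))
    (fun v => (chart_inv a (lsubmx v), chart_inv b (rsubmx v))).

Definition prod_atlas T1 T2 d1 d2 (A : set (chart T1 d1))
    (B : set (chart T2 d2)) : set (chart (T1 * T2) (d1 + d2)) :=
  [set c | exists a b, [/\ A a, B b & c = prod_chart a b]].

(* The dimension d may be 0, so that finite groups are included. *)
Definition lie_group (G : topGroupType) d (A : set (chart G d)) : Prop :=
  [/\ is_manifold A,
      smooth_map (prod_atlas A A) A (fun p : G * G => (p.1 * p.2)%g) &
      smooth_map A A (fun x : G => (x^-1)%g)].

End Manifolds.

Arguments chart : clear implicits.

(* A continuous homomorphism from G to GL_n(C). *)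
Definition is_representation (R : realType) (G : topGroupType) (n : nat)
    (rho : G -> 'M[R[i]]_n) : Prop :=
  [/\ (0 < n)%N,
      forall x, rho x \in unitmx,
      forall x y, rho (x * y)%g = rho x *m rho y &
      continuous rho].

Definition is_component (T : topologicalType) (C : set T) : Prop :=
  exists x : T, C = connected_component [set: T] x.

Definition is_maximum (R : realType) (E : set R) (M : R) : Prop :=
  E M /\ ubound E M.

Definition is_minimum (R : realType) (E : set R) (m : R) : Prop :=
  E m /\ lbound E m.

Definition algebraic_number (R : realType) (z : R[i]) : Prop :=
  algebraicOver (@ratr R[i]) z.

(* Main.v *)
From HB Require Import structures.
Require Import Defs.
From mathcomp Require Import all_boot all_order all_algebra.
From mathcomp Require Import all_classical all_reals all_analysis.
From mathcomp Require Import ring.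

(* Let g maximise Re Tr rho on its component C, and let l_1, ..., l_n be the
   eigenvalues of rho g, which have modulus 1. Some power g^m lies in the
   identity component, so all g^(1+mk) lie in C and
   Re sum_j l_j^(1+mk) <= Re sum_j l_j for all k. By Kronecker's theorem the
   same bound holds for Re sum_j l_j exp(i t theta_j) whenever theta in R^n
   satisfies every additive relation coming from a multiplicative relation
   between the l_j; differentiating at t = 0, sum_j Im(l_j) theta_j = 0.
   If v = Re sum_j l_j = (1/2) sum_j (l_j + 1/l_j) were transcendental, some
   derivation D of a subring of the complex numbers would have D v = 1. But the
   real and imaginary parts of D(l_j)/l_j are such vectors theta, so that
   2 D v = sum_j (l_j - 1/l_j) (D(l_j)/l_j) = 2i sum_j Im(l_j) (D(l_j)/l_j) = 0. *)

Set Implicit Arguments.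
Unset Strict Implicit.
Unset Printing Implicit Defensive.

Import Order.TTheory GRing.Theory Num.Theory.
Import numFieldNormedType.Exports.

Local Open Scope classical_set_scope.
Local Open Scope ring_scope.

(** * Extending derivations *)

Lemma leibniz1 (K A : nzRingType) (ev : {rmorphism A -> K}) (D : {additive A -> K}) :
  (forall a b, D (a * b) = D a * ev b + ev a * D b) -> D 1 = 0.
Proof.
move=> DM; have /eqP := DM 1 1; rewrite rmorph1 !(mulr1, mul1r).
by rewrite -subr_eq0 opprD addNKr oppr_eq0 => /eqP.
Qed.

Section AdjoinElement.
Variables (K : numFieldType) (A : comNzRingType) (ev : {rmorphism A -> K}).
Variables (D : {additive A -> K}) (z w : K).

Definition adjoin_eval (p : {poly A}) : K := (map_poly ev p).[z].

(** The derivation over evaluation at [z] that extends [D] and sends ['X] to [w]: the coefficients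
    are differentiated, and the chain rule accounts for [z]. *)
Definition adjoin_der (p : {poly A}) : K :=
  (map_poly D p).[z] + (map_poly ev p)^`().[z] * w.

Fact adjoin_eval_additive : additive adjoin_eval.
Proof. by move=> p q; rewrite /adjoin_eval rmorphB hornerD hornerN. Qed.

Fact adjoin_eval_multiplicative : multiplicative adjoin_eval.
Proof.
by split=> [p q|]; rewrite /adjoin_eval ?rmorphM ?hornerM ?rmorph1 ?hornerC.
Qed.

HB.instance Definition _ :=
  GRing.isAdditive.Build {poly A} K adjoin_eval adjoin_eval_additive.
HB.instance Definition _ :=
  GRing.isMultiplicative.Build {poly A} K adjoin_eval adjoin_eval_multiplicative.

Fact adjoin_der_additive : additive adjoin_der.
Proof.
move=> p q; rewrite /adjoin_der !raddfB /= !hornerE; ring.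
Qed.

HB.instance Definition _ :=
  GRing.isAdditive.Build {poly A} K adjoin_der adjoin_der_additive.

Hypothesis DM : forall a b, D (a * b) = D a * ev b + ev a * D b.

Lemma adjoin_derM p q :
  adjoin_der (p * q) = adjoin_der p * adjoin_eval q + adjoin_eval p * adjoin_der q.
Proof.
rewrite /adjoin_der /adjoin_eval rmorphM /= derivM.
suff -> : map_poly D (p * q) =
    map_poly D p * map_poly ev q + map_poly ev p * map_poly D q.
  by rewrite !hornerE; ring.
apply/polyP=> i; rewrite coef_map /= coefM raddf_sum coefD !coefM -big_split /=.
by apply: eq_bigr => j _; rewrite DM !coef_map.
Qed.

Lemma adjoin_evalC a : adjoin_eval a%:P = ev a.
Proof. by rewrite /adjoin_eval map_polyC hornerC. Qed.

Lemma adjoin_evalX : adjoin_eval 'X = z.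
Proof. by rewrite /adjoin_eval map_polyX hornerX. Qed.

Lemma adjoin_derC a : adjoin_der a%:P = D a.
Proof. by rewrite /adjoin_der !map_polyC /= derivC horner0 mul0r addr0 hornerC. Qed.

Lemma adjoin_derX : adjoin_der 'X = w.
Proof.
rewrite /adjoin_der map_polyX derivX hornerC mul1r.
suff -> : map_poly D 'X = 0 by rewrite horner0 add0r.
apply/polyP => i; rewrite coef_map coefX coef0.
by case: (i == 1%N); rewrite ?(leibniz1 DM) ?raddf0.
Qed.

End AdjoinElement.

Section ExtendDerivation.
Variables (K : numFieldType) (A : comNzRingType) (ev : {rmorphism A -> K}).
Variables (D : {additive A -> K}) (z : K).
Hypothesis DM : forall a b, D (a * b) = D a * ev b + ev a * D b.
Hypothesis Dker : forall a, ev a = 0 -> D a = 0.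

Local Notation evz := (adjoin_eval ev z).
Local Notation Dz := (adjoin_der ev D z).

Lemma adjoin_der_map0 w p : map_poly ev p = 0 -> Dz w p = 0.
Proof.
move=> p0; rewrite /adjoin_der p0 deriv0 horner0 mul0r addr0.
suff -> : map_poly D p = 0 by rewrite horner0.
apply/polyP => i; rewrite coef_map coef0; apply: Dker.
by rewrite -coef_map /= p0 coef0.
Qed.

Lemma size_le_drop_lead (S : nzSemiRingType) (q : {poly S}) k :
  (size q <= k.+1)%N -> q`_k = 0 -> (size q <= k)%N.
Proof.
move=> /leq_sizeP sq qk; apply/leq_sizeP => j; rewrite leq_eqVlt.
by case/orP=> [/eqP <-//|/sq].
Qed.

(* If z is algebraic over the fraction field of the image of ev, the value of
   the derivation at z is forced by a relation P of minimal degree, and P kills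
   every other relation by pseudo-division; otherwise any value will do. *)
Lemma extend_derivation : exists w, forall q, evz q = 0 -> Dz w q = 0.
Proof.
have [/(_ _ _)/adjoin_der_map0 h|] := pselect (forall q, evz q = 0 -> map_poly ev q = 0).
  by exists 0 => q /h.
move=> /existsNP[P0 /not_implyP[P0z /eqP P0n]].
pose good d := `[< exists P, [/\ evz P = 0, map_poly ev P != 0 & size P = d] >].
have exg : exists d, good d by exists (size P0); apply/asboolP; exists P0.
case: (ex_minnP exg) => d /asboolP[P [Pz Pn Pd]] dmin.
have small (q : {poly A}) : (size q < d)%N -> evz q = 0 -> map_poly ev q = 0.
  move=> sq qz; apply/eqP; apply: contraLR sq => qn; rewrite -leqNgt.
  by apply: dmin; apply/asboolP; exists q.
have P_neq0 : P != 0 by apply: contra_neq Pn => ->; rewrite rmorph0.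
case: d => [|d] in Pd dmin small.
  by move/eqP: Pd; rewrite size_poly_eq0 (negPf P_neq0).
pose l := lead_coef P.
have lE : l = P`_d by rewrite /l lead_coefE Pd.
(* Otherwise dropping the leading term of [P] would shorten it without changing its image, against
   minimality. *)
have ln0 : ev l != 0.
  apply/eqP => l0; pose P1 := P - l%:P * 'X^d.
  have P1E : map_poly ev P1 = map_poly ev P.
    by rewrite rmorphB rmorphM /= map_polyC /= l0 polyC0 mul0r subr0.
  have /(small _) : (size P1 < d.+1)%N.
    apply: size_le_drop_lead.
      rewrite (leq_trans (size_polyD _ _)) // geq_max Pd leqnn size_polyN.
      by rewrite mul_polyC (leq_trans (size_scale_leq _ _)) ?size_polyXn.
    by rewrite coefB coefCM coefXn eqxx mulr1 -lE subrr.
  by rewrite /adjoin_eval P1E => /(_ Pz) /eqP; rewrite (negPf Pn).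
(* Otherwise the derivative of [P] is a shorter relation, so its image is zero; in characteristic 0
   the image of [P] is then constant, equal to its value 0 at [z]. *)
have dPz : (map_poly ev P)^`().[z] != 0.
  apply/eqP => dz; have : map_poly ev P^`() = 0.
    apply: small; last by rewrite /adjoin_eval -deriv_map.
    by rewrite -Pd; apply: lt_size_deriv.
  rewrite -deriv_map /= => d0.
  have pC : map_poly ev P = ((map_poly ev P)`_0)%:P.
    apply/polyP => -[|i]; rewrite coefC //=.
    move/polyP: d0 => /(_ i)/eqP; rewrite coef_deriv coef0 mulrn_eq0 /=.
    by move/eqP.
  move: Pz Pn; rewrite /adjoin_eval pC hornerC => ->.
  by rewrite eqxx.
(* The only value that makes [Dz w P] vanish. *)
exists (- (map_poly D P).[z] / (map_poly ev P)^`().[z]); set w := _ / _.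
have DP : Dz w P = 0 by rewrite /adjoin_der /w; field.
move=> q; have [n] := ubnP (size q); elim: n q => // n IH q sq qz.
have [/small/(_ qz)/adjoin_der_map0//|sqd] := ltnP (size q) d.+1.
(* One step of pseudo-division: the leading terms cancel, and as [evz q], [evz P] and [Dz w P]
   vanish, [Dz w r] reduces to [ev l * Dz w q]. *)
pose k := (size q).-1; pose r := l%:P * q - (lead_coef q)%:P * 'X^(k - d) * P.
have rz : evz r = 0.
  by rewrite raddfB /= !rmorphM /= qz Pz !mulr0 subrr.
have sr : (size r < n)%N.
  rewrite -ltnS; apply: leq_trans sq; rewrite ltnS.
  rewrite -[size q]prednK ?(leq_trans _ sqd)// ltnS -/k.
  have sqk : size q = k.+1 by rewrite prednK ?(leq_trans _ sqd).
  have dk : (d <= k)%N by rewrite -ltnS -sqk.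
  apply: size_le_drop_lead.
    rewrite (leq_trans (size_polyD _ _)) // geq_max size_polyN mul_polyC.
    rewrite (leq_trans (size_scale_leq _ _)) ?sqk //=.
    rewrite -mulrA mul_polyC (leq_trans (size_scale_leq _ _)) //.
    rewrite (leq_trans (size_polyMleq _ _))// size_polyXn Pd addSn /=.
    by rewrite addnS subnK.
  rewrite coefB coefCM -mulrA coefCM coefXnM ltnNge leq_subr /= subKn //.
  by rewrite -lE lead_coefE -/k mulrC subrr.
have /eqP := IH _ sr rz.
rewrite raddfB /= !(adjoin_derM z w DM) /= qz Pz DP !mulr0 !addr0 add0r subr0.
rewrite /adjoin_eval map_polyC hornerC mulf_eq0 (negPf ln0) /=.
by move/eqP.
Qed.

End ExtendDerivation.

(* The derivation is carried by a ring A mapping onto a subring of K, so that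
   nothing has to be checked to be well defined beyond [ker ev <= ker D]. *)
Lemma derivation_nonalgebraic (K : numFieldType) (v : K) (s : seq K) :
  ~ algebraicOver (@ratr K) v ->
  exists (A : comNzRingType) (ev : {rmorphism A -> K}) (D : {additive A -> K}),
    [/\ forall a b, D (a * b) = D a * ev b + ev a * D b,
        forall a, ev a = 0 -> D a = 0,
        exists2 a, ev a = v & D a = 1 &
        forall x, x \in s -> exists a, ev a = x].
Proof.
move=> vtr; elim: s => [|z s [A [ev [D [DM Dker [a av Da] sE]]]]].
  (* The starting ring is that of rational polynomials, evaluated at [v], with formal
     differentiation; evaluation is injective because [v] is not algebraic. *)
  pose D0 : {additive rat -> K} := \0.
  have DM : forall a b : rat, D0 (a * b) = D0 a * ratr b + ratr a * D0 b.
    by move=> a b /=; rewrite mul0r mulr0 addr0.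
  exists {poly rat}, (adjoin_eval (@ratr K) v), (adjoin_der (@ratr K) D0 v 1).
  split=> //; first exact: adjoin_derM.
    move=> p pz; apply: adjoin_der_map0 => //.
    apply/eqP; rewrite map_poly_eq0; apply/negPn/negP => pn.
    by apply: vtr; exists p => //; apply/eqP.
  by exists 'X; [exact: adjoin_evalX | exact: adjoin_derX].
have [w wP] := extend_derivation z DM Dker.
exists {poly A}, (adjoin_eval ev z), (adjoin_der ev D z w).
split=> //; first exact: adjoin_derM.
  by exists a%:P; [rewrite -av; exact: adjoin_evalC | rewrite -Da; exact: adjoin_derC].
move=> x; rewrite inE => /orP[/eqP ->|/sE[b <-]].
  by exists 'X; exact: adjoin_evalX.
by exists b%:P; exact: adjoin_evalC.
Qed.

(** Logarithmic derivatives turn multiplicative relations into additive ones. The last equation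
    comes from applying to [2 * v] a derivation with value 1 at [v]. *)
Lemma log_derivation_nonalgebraic (K : numFieldType) (n : nat)
    (l : 'I_n -> K) (v : K) :
  (forall j, l j != 0) -> 2 * v = \sum_j (l j + (l j)^-1) ->
  ~ algebraicOver (@ratr K) v ->
  exists d : 'I_n -> K,
    (forall a b : 'I_n -> nat, \prod_j l j ^+ a j = \prod_j l j ^+ b j ->
       \sum_j d j *+ a j = \sum_j d j *+ b j) /\
    \sum_j (l j - (l j)^-1) * d j = 2.
Proof.
(* The inverses are listed too, since [A] is only a ring. *)
move=> l0 vE /(derivation_nonalgebraic ([seq l j | j <- enum 'I_n]
  ++ [seq (l j)^-1 | j <- enum 'I_n])).
move=> [A [ev [D [DM Dker [a av Da] sE]]]].
have Deq x y : ev x = ev y -> D x = D y.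
  move=> exy; apply/eqP; rewrite -subr_eq0 -raddfB; apply/eqP/Dker.
  by rewrite rmorphB /= exy subrr.
have /fin_all_exists[x xE] j : exists x, ev x = l j.
  by apply: sE; rewrite mem_cat map_f ?mem_enum.
have /fin_all_exists[y yE] j : exists y, ev y = (l j)^-1.
  by apply: sE; rewrite mem_cat (map_f (fun j => (l j)^-1)) ?orbT ?mem_enum.
have D1 := leibniz1 DM.
have DX j m : D (x j ^+ m) = l j ^+ m * (D (x j) / l j *+ m).
  elim: m => [|m IH]; first by rewrite expr0 D1 mulr0n mulr0.
  rewrite exprS DM IH rmorphXn /= xE mulrSr [in RHS]exprS.
  by field; exact: l0.
have Dprod m : D (\prod_j x j ^+ m j)
    = \prod_j l j ^+ m j * \sum_j D (x j) / l j *+ m j.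
  suff [] : D (\prod_j x j ^+ m j)
      = \prod_j l j ^+ m j * \sum_j D (x j) / l j *+ m j /\
      ev (\prod_j x j ^+ m j) = \prod_j l j ^+ m j by [].
  elim/big_ind3: _ => [|p p' s q q' r [Dp ep] [Dq eq]|j _].
  - by rewrite D1 mulr0 rmorph1.
  - by rewrite DM rmorphM /= Dp Dq ep eq; split=> //; ring.
  - by rewrite DX rmorphXn /= xE.
exists (fun j => D (x j) / l j); split.
  move=> m m' mm'; apply: (@mulfI _ (\prod_j l j ^+ m j)).
    by apply/prodf_neq0 => j _; rewrite expf_neq0.
  rewrite -Dprod mm' -Dprod; apply: Deq.
  by rewrite !rmorph_prod; under eq_bigr do rewrite rmorphXn /= xE;
     under [RHS]eq_bigr do rewrite rmorphXn /= xE.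
have Dy j : D (y j) = - (l j)^-2 * D (x j).
  have /Deq : ev (x j * y j) = ev 1 by rewrite rmorphM /= xE yE rmorph1 mulfV.
  rewrite DM D1 xE yE => /eqP; rewrite addrC addr_eq0 => /eqP h.
  by apply: (mulfI (l0 j)); rewrite h; field; exact: l0.
have : D (a + a) = D (\sum_j (x j + y j)).
  apply: Deq; rewrite rmorphD /= av -[v + v]mulr2n -mulr_natl vE rmorph_sum.
  by apply: eq_bigr => j _; rewrite rmorphD /= xE yE.
rewrite raddfD /= Da raddf_sum => h; rewrite -[RHS]/(1 + 1) h.
apply: eq_bigr => j _; rewrite raddfD /= Dy.
by field; exact: l0.
Qed.

(** * Kronecker's theorem *)

Section Kronecker.
Variable C : numClosedFieldType.
Hypothesis archi : Num.archimedean_axiom C.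

(** Multiplying by [w - 1] telescopes the sum to [w ^+ N - 1], of modulus at most 2. *)
Lemma geometric_sum_bounded (w : C) N : `|w| = 1 -> w != 1 ->
  `|\sum_(k < N) w ^+ k| <= 2 / `|w - 1|.
Proof.
move=> w1 wn; rewrite ler_pdivlMr ?normr_gt0 ?subr_eq0// -normrM mulrC -subrX1.
by rewrite (le_trans (ler_normB _ _))// normrX w1 expr1n normr1.
Qed.

(** Expanding the square gives a double sum over [i] and [j]: pairs with [w j = w i] contribute [N]
    times their coefficient, every other pair a geometric sum bounded uniformly in [N]. *)
Lemma mean_square_exponential_sum (I : finType) (c w : I -> C) :
  (forall i, `|w i| = 1) ->
  exists B, forall N, `|\sum_(k < N) `|\sum_i c i * w i ^+ k| ^+ 2
    - N%:R * \sum_i \sum_(j | w j == w i) c i * (c j)^*| <= B.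
Proof.
move=> w1.
exists (\sum_i \sum_(j | w j != w i) `|c i * (c j)^*| * (2 / `|w i * (w j)^* - 1|)).
move=> N.
have -> : \sum_(k < N) `|\sum_i c i * w i ^+ k| ^+ 2 =
    \sum_i \sum_j c i * (c j)^* * \sum_(k < N) (w i * (w j)^*) ^+ k.
  under eq_bigr => k _.
    rewrite normCK rmorph_sum mulr_suml.
    under eq_bigr do rewrite mulr_sumr.
    over.
  rewrite exchange_big; apply: eq_bigr => i _; rewrite exchange_big.
  apply: eq_bigr => j _; rewrite mulr_sumr; apply: eq_bigr => k _.
  by rewrite rmorphM rmorphXn /= exprMn; ring.
have wJ i : w i * (w i)^* = 1 by rewrite -normCK w1 expr1n.
rewrite mulr_sumr -sumrB (le_trans (ler_norm_sum _ _ _))//.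
apply: ler_sum => i _; rewrite (bigID (fun j => w j == w i)) /=.
rewrite [X in X + _ - _](_ : _ = N%:R * \sum_(j | w j == w i) c i * (c j)^*); last first.
  rewrite mulr_sumr; apply: eq_bigr => j /eqP wji; rewrite wji wJ.
  under eq_bigr do rewrite expr1n.
  by rewrite sumr_const card_ord mulrC.
rewrite addrC addKr (le_trans (ler_norm_sum _ _ _))//.
apply: ler_sum => j wji; rewrite normrM ler_wpM2l ?normr_ge0//.
apply: geometric_sum_bounded; first by rewrite normrM norm_conjC !w1 mulr1.
apply: contra_neq wji => wji.
have := congr1 (fun u => u * w j) wji.
by rewrite -mulrA [_^* * _]mulrC wJ mulr1 mul1r => ->.
Qed.

Lemma exp_beats_pow (q : C) n : 0 <= q -> q < 1 ->
  exists p, p.+1%:R ^+ n * q ^+ p < 1.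
Proof.
move=> q0 q1; case: n => [|n]; first by exists 1%N; rewrite expr0 mul1r.
pose d := 1 - q; have d0 : 0 < d by rewrite subr_gt0.
have bern t : q ^+ t * (1 + t%:R * d) <= 1.
  elim: t => [|t IH]; first by rewrite expr0 mul0r addr0 mulr1.
  apply: le_trans IH; rewrite exprSr -mulrA ler_wpM2l ?exprn_ge0//.
  rewrite -subr_ge0 -natr1.
  have -> : 1 + t%:R * d - q * (1 + (t%:R + 1) * d) = (1 - q) * d + t%:R * d * d.
    by rewrite /d; ring.
  by rewrite addr_ge0// !mulr_ge0// ?ler0n// ltW.
(* For this [t] and [p = n.+1 * (2 * t)], the square of [1 + t * d] exceeds [p.+1], while [bern]
   bounds [q ^+ (2 * t)] by the inverse of that square. *)
have [t] := archi (2 * n.+1%:R / d ^+ 2).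
rewrite ger0_norm ?divr_ge0 ?mulr_ge0 ?exprn_ge0 ?ler0n// ?(ltW d0)//.
rewrite ltr_pdivrMr ?exprn_gt0// => tE.
have t0 : (0 : C) < t%:R.
  by rewrite -(pmulr_lgt0 _ (exprn_gt0 2 d0)) (le_lt_trans _ tE)// mulr_ge0 ?ler0n.
exists (n.+1 * (2 * t))%N; rewrite mulnC exprM -exprMn exprn_ilt1 //.
  by rewrite mulr_ge0 ?ler0n ?exprn_ge0.
have X0 : 0 < 1 + t%:R * d by rewrite ltr_wpDr ?ltr01// mulr_ge0// ltW.
rewrite -(ltr_pM2r (exprn_gt0 2 X0)) mul1r mulnC.
apply: (@le_lt_trans _ _ (n.+1 * (2 * t)).+1%:R).
  rewrite -mulrA ler_piMr ?ler0n// mulnC exprM -exprMn exprn_ile1//.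
  by rewrite mulr_ge0 ?exprn_ge0 // ltW.
apply: (@lt_le_trans _ _ (1 + 2 * t%:R * d + t%:R * (t%:R * d ^+ 2))); last first.
  by rewrite -subr_ge0 [leRHS](_ : _ = 0)//; ring.
apply: (@lt_trans _ _ (1 + t%:R * (t%:R * d ^+ 2))).
  by rewrite -natr1 !natrM addrC ltrD2l mulrA mulrC ltr_pM2l// mulrC.
by rewrite ltrD2r ltrDl !mulr_gt0.
Qed.

(** By Bernoulli's inequality the powers of a number of modulus above 1 grow at least linearly. *)
Lemma bounded_powers_le1 (z M : C) : (forall k, `|z ^+ k| <= M) -> `|z| <= 1.
Proof.
move=> zM; rewrite real_leNgt ?normr_real//; apply/negP => z1.
pose d := `|z| - 1; have d0 : 0 < d by rewrite subr_gt0.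
have bern k : 1 + k%:R * d <= `|z| ^+ k.
  elim: k => [|k IH]; first by rewrite mul0r addr0.
  rewrite exprSr (le_trans _ (ler_wpM2r (normr_ge0 z) IH))// -subr_ge0.
  have -> : (1 + k%:R * d) * `|z| - (1 + k.+1%:R * d) = k%:R * d * d.
    by rewrite /d -natr1; ring.
  by rewrite !mulr_ge0// ?ler0n// ltW.
have [k] := archi (M / d).
have M0 : 0 <= M by rewrite (le_trans _ (zM 0%N)).
rewrite ger0_norm ?divr_ge0 ?(ltW d0)// ltr_pdivrMr// => Mk.
have := le_trans (bern k) (le_trans _ (zM k)); rewrite normrX => /(_ (lexx _)) kM.
by have := le_lt_trans kM Mk; rewrite gtrDr ltr10.
Qed.

(** The coefficients are products of binomial probabilities, so they are nonnegative and sum to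
    1. *)
Lemma binomial_product (n p : nat) (u : 'I_n -> C) :
  \prod_j ((1 + u j) / 2) ^+ p =
  \sum_(a : {ffun 'I_n -> 'I_p.+1})
    (\prod_j ('C(p, a j)%:R / 2 ^+ p)) * \prod_j u j ^+ a j.
Proof.
under eq_bigr => j _.
  rewrite expr_div_n exprDn mulr_suml.
  under eq_bigr do rewrite expr1n mul1r.
  over.
rewrite bigA_distr_bigA; apply: eq_bigr => a _; rewrite -big_split /=.
by apply: eq_bigr => j _; rewrite -mulr_natl mulrAC.
Qed.

(** Cauchy-Schwarz, read off from the squared deviations from the mean [#|I|%:R^-1]. *)
Lemma sum_squares_ge (I : finType) (c : I -> C) :
  (forall i, 0 <= c i) -> \sum_i c i = 1 ->
  1 <= #|I|%:R * \sum_i c i ^+ 2.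
Proof.
move=> c0 c1; have [I0|I0] := posnP #|I|.
  move: c1; rewrite big_pred0 => [/eqP|i]; first by rewrite eq_sym oner_eq0.
  by have := fintype0 i I0.
have In : (#|I|%:R : C) != 0 by rewrite pnatr_eq0 -lt0n.
rewrite -subr_ge0.
suff -> : #|I|%:R * \sum_i c i ^+ 2 - 1 = #|I|%:R * \sum_i (c i - #|I|%:R^-1) ^+ 2.
  rewrite mulr_ge0 ?ler0n// sumr_ge0// => i _; rewrite -realEsqr.
  by rewrite rpredB ?rpredV ?ger0_real ?ler0n.
under [in RHS]eq_bigr do rewrite sqrrB.
rewrite !big_split /= sumrN sumrMnl -mulr_suml c1 sumr_const.
by rewrite -[_ *+ #|_|]mulr_natl -[_ *+ 2]mulr_natl; field.
Qed.

(* With u_j = mu_j^k / x_j, the mean over k of |prod_j ((1 + u_j) / 2)^p|^2 is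
   at least 1 / (p+1)^n: the cross terms surviving in the mean are nonnegative
   because x satisfies the relations of mu. If no k were good, this quantity
   would be at most q^p for some fixed q < 1. *)
Lemma kronecker_density (n : nat) (mu x : 'I_n -> C) (e : C) :
  (forall j, `|mu j| = 1) -> (forall j, `|x j| = 1) ->
  (forall a b : 'I_n -> nat, \prod_j mu j ^+ a j = \prod_j mu j ^+ b j ->
     \prod_j x j ^+ a j = \prod_j x j ^+ b j) ->
  0 < e -> exists k, forall j, `|mu j ^+ k - x j| < e.
Proof.
move=> mu1 x1 rel e0; apply: contrapT => /forallNP far.
pose u k j := mu j ^+ k * (x j)^*.
have u1 k j : `|u k j| = 1 by rewrite /u normrM normrX mu1 expr1n norm_conjC x1 mulr1.
have xJ j : x j * (x j)^* = 1 by rewrite -normCK x1 expr1n.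
have uE k j : `|u k j - 1| = `|mu j ^+ k - x j|.
  by rewrite /u -[1](xJ j) -mulrBl normrM norm_conjC x1 mulr1.
(* For [u] of modulus 1 the parallelogram identity reads [|1 + u|^2 + |u - 1|^2 = 4]. *)
have sqE k j : `|(1 + u k j) / 2| ^+ 2 = 1 - `|mu j ^+ k - x j| ^+ 2 / 4.
  rewrite -uE !normCK rmorphM rmorphD rmorphB /= fmorphV rmorph1 rmorph_nat.
  have : u k j * (u k j)^* = 1 by rewrite -normCK u1 expr1n.
  by set v := u k j; set v' := v^* => vv; field: vv.
pose q : C := 1 - e ^+ 2 / 4.
have q1 : q < 1 by rewrite /q ltrBlDr ltrDl divr_gt0 ?exprn_gt0.
have farP k : exists2 j, true & e <= `|mu j ^+ k - x j|.
  have /existsNP[j /negP] := far k; rewrite -real_leNgt ?normr_real ?gtr0_real//.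
  by exists j.
have far_le k j : e <= `|mu j ^+ k - x j| -> `|(1 + u k j) / 2| ^+ 2 <= q.
  move=> ej; rewrite sqE lerD2l lerN2 ler_pM2r ?invr_gt0//.
  by rewrite lerXn2r ?nnegrE ?normr_ge0 ?(ltW e0).
have q0 : 0 <= q.
  by have [j _ /far_le] := farP 0%N; apply: le_trans; rewrite exprn_ge0.
have [p pq] := exp_beats_pow n q0 q1.
have Qle k : `|\prod_j ((1 + u k j) / 2) ^+ p| ^+ 2 <= q ^+ p.
  have [j _ /far_le ej] := farP k.
  rewrite (bigD1 j) //= normrM exprMn normrX -exprM mulnC exprM.
  rewrite -[leRHS]mulr1 ler_pM ?exprn_ge0//.
    by rewrite lerXn2r ?nnegrE ?exprn_ge0.
  rewrite exprn_ile1 // normr_prod prodr_ile1// => i _.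
  rewrite normr_ge0 normrX exprn_ile1 ?normr_ge0// normrM normfV [`|2|]ger0_norm ?ler0n//.
  by rewrite ler_pdivrMr// mul1r (le_trans (ler_normD _ _))// normr1 u1.
pose I := {ffun 'I_n -> 'I_p.+1}.
pose coef (a : I) : C := \prod_j ('C(p, a j)%:R / 2 ^+ p).
pose w (a : I) := \prod_j mu j ^+ a j.
pose c (a : I) := coef a * \prod_j (x j)^* ^+ a j.
have coef0 a : 0 <= coef a.
  by rewrite prodr_ge0// => j _; rewrite divr_ge0 ?exprn_ge0 ?ler0n.
have coef1 : \sum_a coef a = 1.
  transitivity (\prod_(j < n) ((1 + 1) / 2 : C) ^+ p).
    rewrite binomial_product; apply: eq_bigr => a _.
    by rewrite [X in _ * X]big1 ?mulr1// => j _; rewrite expr1n.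
  by rewrite big1// => j _; rewrite -[1 + 1]/2 divff ?pnatr_eq0// expr1n.
have Qsum k : \prod_j ((1 + u k j) / 2) ^+ p = \sum_a c a * w a ^+ k.
  rewrite binomial_product; apply: eq_bigr => a _; rewrite -mulrA; congr (_ * _).
  rewrite -prodrXl -big_split; apply: eq_bigr => j _ /=.
  by rewrite /u exprMn mulrC -!exprM mulnC.
have w1 a : `|w a| = 1.
  by rewrite normr_prod big1// => j _; rewrite normrX mu1 expr1n.
have [B BP] := mean_square_exponential_sum c w1.
set T := \sum_i _ in BP.
(* When [w b = w a], [rel] equates the corresponding monomials in [x], so the phases of [c a] and
   [c b] cancel. *)
have TE : T = \sum_a \sum_(b | w b == w a) coef a * coef b.
  apply: eq_bigr => a _; apply: eq_bigr => b /eqP wab.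
  rewrite /c rmorphM /= (geC0_conj (coef0 b)) mulrACA -[RHS]mulr1; congr (_ * _).
  rewrite rmorph_prod; under [X in _ * X]eq_bigr do rewrite rmorphXn /= conjCK.
  have -> := rel (fun j => b j) (fun j => a j) wab.
  rewrite -big_split big1// => j _ /=; rewrite -exprMn mulrC xJ expr1n //.
(* Only the terms [b = a] are kept; there are [p.+1 ^ n] of them, with weights of sum 1. *)
have T1 : 1 <= p.+1%:R ^+ n * T.
  have := sum_squares_ge coef0 coef1; rewrite card_ffun !card_ord natrX.
  move=> /le_trans; apply; rewrite ler_wpM2l ?exprn_ge0 ?ler0n// TE.
  apply: ler_sum => a _; rewrite (bigD1 a) //= -expr2 lerDl sumr_ge0// => b _.
  by rewrite mulr_ge0.
have qT : q ^+ p < T.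
  by rewrite -(ltr_pM2l (exprn_gt0 n (ltr0Sn C p))) (lt_le_trans pq).
have Treal : T \is Num.real.
  by rewrite ger0_real// (le_trans _ (ltW qT))// exprn_ge0.
(* The sum of the first [N] squares is at most [N * q ^+ p], yet within [B] of [N * T]; as
   [q ^+ p < T], this fails for large [N]. *)
have NB N : N%:R * (T - q ^+ p) <= B.
  apply: le_trans (BP N); rewrite distrC; apply: le_trans (real_ler_norm _).
    rewrite mulrBr lerD2l lerN2 (le_trans (ler_sum _ (G := fun=> q ^+ p) _))//.
      by move=> k _; rewrite -Qsum.
    by rewrite sumr_const card_ord mulr_natl.
  apply: realB; first exact: realM (realn _ N) Treal.
  by rewrite ger0_real// sumr_ge0// => k _; rewrite exprn_ge0.
have [N] := archi (B / (T - q ^+ p)).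
have d0 : 0 < T - q ^+ p by rewrite subr_gt0.
have B0 : 0 <= B by have := NB 0%N; rewrite mul0r.
rewrite ger0_norm ?divr_ge0 ?(ltW d0)// ltr_pdivrMr// => /lt_le_trans/(_ (NB N)).
by rewrite ltxx.
Qed.

End Kronecker.

(** * Critical points of traces *)

Local Open Scope complex_scope.

Section Complex.
Variable R : realType.

Lemma complex_archimedean : Num.archimedean_axiom R[i].
Proof.
move=> z; rewrite normc_def; set r := Num.sqrt _.
exists (Num.bound r); 
by rewrite -(rmorph_nat (real_complex R)) ltcR archi_boundP ?sqrtr_ge0.
Qed.

Definition cis (t : R) : R[i] := cos t +i* sin t.

Lemma cis0 : cis 0 = 1.
Proof. by rewrite /cis cos0 sin0. Qed.

Lemma cisD s t : cis (s + t) = cis s * cis t.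
Proof. by rewrite /cis cosD sinD; simpc; congr (_ +i* _); rewrite addrC. Qed.

Lemma cisMn t k : cis (t *+ k) = cis t ^+ k.
Proof. by elim: k => [|k IH]; rewrite ?mulr0n ?cis0// mulrS cisD IH exprS. Qed.

Lemma cis_sum (I : finType) (t : I -> R) : cis (\sum_i t i) = \prod_i cis (t i).
Proof. by elim/big_ind2: _ => [|x y s' t' <- <-|//]; rewrite ?cis0 ?cisD. Qed.

Lemma norm_cis t : `|cis t| = 1.
Proof. by rewrite normc_def /= cos2Dsin2 sqrtr1. Qed.

Lemma Re_sum (I : finType) (F : I -> R[i]) :
  complex.Re (\sum_i F i) = \sum_i complex.Re (F i).
Proof. by apply: (big_morph (@complex.Re R)) => // -[? ?] [? ?]. Qed.

Lemma Re_norm_le (z : R[i]) (e : R) : `|z| <= e%:C -> `|complex.Re z| <= e.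
Proof. by rewrite -lecR; apply: le_trans; exact: normc_ge_Re. Qed.

(* s = 1 describes a maximum and s = -1 a minimum. *)
Lemma critical_trace (n : nat) (l : 'I_n -> R[i]) (m : nat) (s : R)
    (theta : 'I_n -> R) :
  (forall j, `|l j| = 1) -> s != 0 ->
  (forall k, s * complex.Re (\sum_j l j ^+ (1 + m.+1 * k))
     <= s * complex.Re (\sum_j l j)) ->
  (forall a b : 'I_n -> nat, \prod_j l j ^+ a j = \prod_j l j ^+ b j ->
     \sum_j theta j *+ a j = \sum_j theta j *+ b j) ->
  \sum_j complex.Im (l j) * theta j = 0.
Proof.
move=> l1 s0 lmax rel.
pose h (t : R) := \sum_j (complex.Re (l j) * cos (theta j * t)
  - complex.Im (l j) * sin (theta j * t)).
have hE t : h t = complex.Re (\sum_j l j * cis (theta j * t)).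
  rewrite Re_sum; apply: eq_bigr => j _.
  by case: (l j) => a b; rewrite /cis; simpc.
(* Density provides [k] with each [(l j ^+ m.+1) ^+ k] close to [cis (theta j * t)], so [h t] is
   close to a value controlled by [lmax]. *)
have hmax t : s * h t <= s * h 0.
  apply/ler_addgt0Pr => e e0.
  (* Using [n.+1] keeps the denominator nonzero when [n = 0]. *)
  pose e' := e / (`|s| * n.+1%:R).
  have e'0 : 0 < e' by rewrite divr_gt0// mulr_gt0 ?normr_gt0.
  have e'C : 0 < e'%:C by rewrite ltcR.
  have [||a b ab|//|k kE] := @kronecker_density R[i] complex_archimedean n
    (fun j => l j ^+ m.+1) (fun j => cis (theta j * t)) e'%:C.
  - by move=> j; rewrite normrX l1 expr1n.
  - by move=> j; exact: norm_cis.
  (* A relation between the [l j ^+ m.+1] is one between the [l j] with exponents multiplied by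
     [m.+1]; this factor cancels from the additive relation. *)
  - under eq_bigr do rewrite -cisMn; under [RHS]eq_bigr do rewrite -cisMn.
    rewrite -!cis_sum; congr cis.
    under eq_bigr do rewrite -mulrnAl; under [RHS]eq_bigr do rewrite -mulrnAl.
    rewrite -!mulr_suml; congr (_ * _); apply: (@pmulrnI _ m.+1 isT).
    rewrite -!sumrMnl; under eq_bigr do rewrite -mulrnA mulnC.
    under [RHS]eq_bigr do rewrite -mulrnA mulnC.
    apply: rel; move: ab; under eq_bigr do rewrite -exprM.
    by under [X in _ = X -> _]eq_bigr do rewrite -exprM.
  rewrite (hE 0).
  under [X in _ <= s * complex.Re X + _]eq_bigr do rewrite mulr0 cis0 mulr1.
  rewrite -lerBlDl (le_trans (lerB (lexx _) (lmax k)))//.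
  rewrite -mulrBr hE.
  have -> : complex.Re (\sum_j l j * cis (theta j * t))
      - complex.Re (\sum_j l j ^+ (1 + m.+1 * k))
    = \sum_j complex.Re (l j * (cis (theta j * t) - (l j ^+ m.+1) ^+ k)).
    rewrite !Re_sum -sumrB; apply: eq_bigr => j _.
    by rewrite exprD expr1 exprM mulrBr; case: (_ * cis _); case: (_ * _).
  rewrite (le_trans (ler_norm _))// normrM -ler_pdivlMl ?normr_gt0//.
  rewrite (le_trans (ler_norm_sum _ _ _))//.
  rewrite (le_trans (ler_sum _ (G := fun=> e') _))//.
    move=> j _; apply: Re_norm_le.
    by rewrite normrM l1 mul1r distrC ltW.
  have -> : `|s|^-1 * e = e' *+ n.+1.
    by rewrite /e' -[RHS]mulr_natr; field; rewrite nat1r pnatr_eq0 normr_eq0.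
  by rewrite sumr_const card_ord mulrS lerDr ltW.
have dh t : is_derive (t : R) (1 : R) h
    (\sum_j (- complex.Re (l j) * theta j * sin (theta j * t)
      - complex.Im (l j) * theta j * cos (theta j * t))).
  have -> : h = \sum_j ((complex.Re (l j) \*: (cos \o ( *%R (theta j))))
      - (complex.Im (l j) \*: (sin \o ( *%R (theta j))))).
    by apply/funext => u; rewrite fct_sumE.
  apply: is_derive_sum => j.
  have dl : is_derive (t : R) (1 : R) ( *%R (theta j)) (theta j).
    rewrite -[X in is_derive _ _ _ X]mulr1.
    exact: (is_deriveZ (theta j) (is_derive_id t 1)).
  have dc := is_derive1_comp (is_derive_cos (theta j * t)) dl.
  have ds := is_derive1_comp (is_derive_sin (theta j * t)) dl.
  apply: is_derive_eq (is_deriveB (is_deriveZ _ dc) (is_deriveZ _ ds)) _.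
  by rewrite /GRing.scale /=; ring.
have d0 : is_derive (0 : R) 1 (s \*: h) 0.
  apply: (@derive1_at_max _ _ (-1) 1) => [|t _||t _]; rewrite ?in_itv/=.
  - by rewrite -subr_ge0 opprK addr_ge0 ?ler01.
  - by have [] := is_deriveZ s (dh t).
  - by rewrite ltrN10 ltr01.
  - exact: hmax.
have /eqP := @derive_val _ _ _ _ _ _ _ d0.
have -> := @derive_val _ _ _ _ _ _ _ (is_deriveZ s (dh 0)).
rewrite scaler_eq0 (negPf s0) /= => /eqP h0.
apply/eqP; rewrite -oppr_eq0 -sumrN; apply/eqP; rewrite -[RHS]h0.
by apply: eq_bigr => j _; rewrite !mulr0 sin0 cos0 mulr0 mulr1 add0r.
Qed.

End Complex.

Lemma unit_complex_inv (R : realType) (z : R[i]) : `|z| = 1 -> z^-1 = z^*.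
Proof. by move=> z1; rewrite invc_norm z1 expr1n invr1 mul1r. Qed.

Lemma algebraic_trace (R : realType) (n : nat) (l : 'I_n -> R[i]) (m : nat) (s : R) :
  (forall j, `|l j| = 1) -> s != 0 ->
  (forall k, s * complex.Re (\sum_j l j ^+ (1 + m.+1 * k))
     <= s * complex.Re (\sum_j l j)) ->
  algebraic_number (complex.Re (\sum_j l j))%:C.
Proof.
move=> l1 s0 lmax; apply: contrapT => vtr.
have l0 j : l j != 0 by rewrite -normr_eq0 l1 oner_eq0.
have [|d [drel d2]] := @log_derivation_nonalgebraic R[i] n l _ l0 _ vtr.
  rewrite Re_sum rmorph_sum mulr_sumr; apply: eq_bigr => j _.
  by rewrite -addcJ unit_complex_inv.
(* Here [f] stands for the real or the imaginary part: [critical_trace] takes real vectors, whereas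
   [d] is complex. *)
have rel (f : R[i] -> R) : {morph f : x y / x + y} -> f 0 = 0 ->
    \sum_j complex.Im (l j) * f (d j) = 0.
  move=> fD f0; apply: (critical_trace l1 s0 lmax) => a b /drel/(congr1 f).
  have fMn x k : f (x *+ k) = f x *+ k.
    by elim: k => [|k IH]; rewrite ?mulr0n// !mulrS fD IH.
  rewrite !(big_morph f fD f0).
  by under eq_bigr do rewrite fMn; under [X in _ = X -> _]eq_bigr do rewrite fMn.
have reD : {morph (@complex.Re R) : x y / x + y} by move=> [? ?] [? ?].
have imD : {morph (@complex.Im R) : x y / x + y} by move=> [? ?] [? ?].
have re0 := rel _ reD erefl; have im0 := rel _ imD erefl.
suff : \sum_j (l j - (l j)^-1) * d j = 0.
  by move/eqP; rewrite d2 pnatr_eq0.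
(* On the unit circle the inverse is the conjugate. *)
transitivity (2 * 'i%C * \sum_j (complex.Im (l j))%:C * d j).
  rewrite mulr_sumr; apply: eq_bigr => j _.
  by rewrite unit_complex_inv// subcJ mulrA [2 * 'i%C * _]mulrAC.
suff : \sum_j (complex.Im (l j))%:C * d j = 0 by move=> ->; rewrite mulr0.
apply/eqP; rewrite eq_complex; apply/andP; split; apply/eqP.
  rewrite Re_sum -[RHS]re0; apply: eq_bigr => j _.
  by case: (d j) => x y; simpc.
rewrite (big_morph _ imD (erefl : complex.Im 0 = 0)) -[RHS]im0.
by apply: eq_bigr => j _; case: (d j) => x y; simpc.
Qed.

(** * Triangular matrices and eigenvalues of powers *)

Section Triangular.
Variables (C : fieldType) (n : nat).
Implicit Types A B T : 'M[C]_n.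

Lemma trig_mulmx A B : is_trig_mx A -> is_trig_mx B -> is_trig_mx (A *m B).
Proof.
move=> /is_trig_mxP At /is_trig_mxP Bt; apply/is_trig_mxP => i j ij.
rewrite mxE big1// => k _; have [ik|ki] := ltnP i k; first by rewrite At// mul0r.
by rewrite Bt ?mulr0// (leq_ltn_trans ki).
Qed.

Lemma trig_mulmx_diag A B i : is_trig_mx A -> is_trig_mx B ->
  (A *m B) i i = A i i * B i i.
Proof.
move=> /is_trig_mxP At /is_trig_mxP Bt; rewrite mxE (bigD1 i)//= big1 ?addr0//.
move=> k ki; have [ik|] := ltnP i k; first by rewrite At// mul0r.
by rewrite leq_eqVlt val_eqE (negPf ki) /= => {}ki; rewrite Bt ?mulr0.
Qed.

Lemma trig_powers T (B : nat -> 'M[C]_n) : is_trig_mx T ->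
  B 0%N = 1%:M -> (forall k, B k.+1 = T *m B k) ->
  forall k, is_trig_mx (B k) /\ forall i, B k i i = T i i ^+ k.
Proof.
move=> Tt B0 BS; elim=> [|k [IHt IH]].
  by rewrite B0 scalar_mx_is_trig; split=> // i; rewrite mxE eqxx.
by rewrite BS; split=> [|i]; [exact: trig_mulmx | rewrite trig_mulmx_diag// IH exprS].
Qed.

End Triangular.

(* A and its inverse are put in triangular form simultaneously, which relates
   their eigenvalues index by index. *)
Lemma eigenvalues_powers (C : numClosedFieldType) (n : nat) (B B' : nat -> 'M[C]_n) :
  B 0%N = 1%:M -> (forall k, B k.+1 = B 1%N *m B k) ->
  B' 0%N = 1%:M -> (forall k, B' k.+1 = B' 1%N *m B' k) ->
  B 1%N *m B' 1%N = 1%:M -> B' 1%N *m B 1%N = 1%:M ->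
  exists P (l l' : 'I_n -> C), [/\ P \in unitmx, forall i, l i * l' i = 1,
    forall k i, (P *m B k *m invmx P) i i = l i ^+ k &
    forall k i, (P *m B' k *m invmx P) i i = l' i ^+ k].
Proof.
move=> B0 BS B'0 B'S BB' B'B.
have [P /unitarymx_unit Pu /andP[]] := cotrigonalization2 (etrans BB' (esym B'B)).
rewrite /similar_to /= !conjumx// => Tt Tt'.
have cM X Y : P *m (X *m Y) *m invmx P = (P *m X *m invmx P) *m (P *m Y *m invmx P).
  by rewrite !mulmxA mulmxKV.
have c1 : P *m 1%:M *m invmx P = 1%:M by rewrite mulmx1 mulmxV.
exists P, (fun i => (P *m B 1%N *m invmx P) i i), (fun i => (P *m B' 1%N *m invmx P) i i).
split=> // [i|k i|k i].
- by rewrite -trig_mulmx_diag// -cM BB' c1 mxE eqxx.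
- apply: (trig_powers (B := fun k => P *m B k *m invmx P) Tt _ _ k).2 => [|{}k] /=.
    by rewrite B0.
  by rewrite BS cM.
- apply: (trig_powers (B := fun k => P *m B' k *m invmx P) Tt' _ _ k).2 => [|{}k] /=.
    by rewrite B'0.
  by rewrite B'S cM.
Qed.

(** * Lie groups and representations *)

Section Components.
Variable G : topGroupType.
Hypothesis mulG_continuous : continuous (fun p : G * G => (p.1 * p.2)%g).
Local Notation component x := (connected_component [set: G] x).

Lemma lmulg_continuous (g : G) : continuous (fun x : G => (g * x)%g).
Proof.
move=> x; apply: (@continuous_comp _ _ _ (fun x : G => (g, x))
  (fun p : G * G => (p.1 * p.2)%g)).
  by apply: cvg_pair; [exact: cvg_cst | exact: cvg_id].
exact: mulG_continuous.
Qed.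

Lemma component_mulg (g x y : G) :
  component x y -> component (g * x)%g (g * y)%g.
Proof.
move=> [B [Bx _ Bc By]]; exists [set (g * z)%g | z in B]; last by exists y.
split=> //; first by exists x.
apply: connected_continuous_connected => //.
exact/continuous_subspaceT/lmulg_continuous.
Qed.

(** Left translation by [g * h ^+ k] carries [1] and [h] to consecutive terms, which therefore share
    a component. *)
Lemma component_expg (g h : G) k : component 1%g h -> component g (g * h ^+ k)%g.
Proof.
move=> h1; elim: k => [|k IH].
  by rewrite expg0 mulg1; exact: connected_component_refl.
apply: connected_component_trans IH _; rewrite expgSr mulgA.
by have := component_mulg (g * h ^+ k)%g h1; rewrite mulg1.
Qed.

Hypothesis invG_continuous : continuous (fun x : G => (x^-1)%g).

(** By compactness the powers of [g] cluster at some [p]; two of them close to [p] have a quotient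
    close to [1], hence in its component. *)
Lemma expg_component1 (g : G) : compact [set: G] -> nbhs 1%g (component 1%g) ->
  exists m, component 1%g (g ^+ m.+1)%g.
Proof.
move=> cG n1.
have [p [_ clp]] := cG ((fun i => (g ^+ i)%g) @ \oo) _ filterT.
have := @mulG_continuous ((p^-1)%g, p) (component 1%g).
rewrite /= mulVg => /(_ n1) [[V1 V2]] /= [V1p V2p] V12.
pose V := V2 `&` (fun x : G => (x^-1)%g) @^-1` V1.
have Vp : nbhs p V by apply: filterI => //; exact: invG_continuous.
have freq N : exists2 i, (N <= i)%N & V (g ^+ i)%g.
  have [|x [[i Ni <-] Vi]] := clp [set (g ^+ i)%g | i in [set i | (N <= i)%N]] V _ Vp.
    by exists N => // i Ni; exists i.
  by exists i.
have [i _ Vi] := freq 0%N; have [j ij Vj] := freq i.+1.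
exists (j - i.+1)%N.
have := V12 ((g ^+ i)^-1, g ^+ j)%g (conj Vi.2 Vj.1).
by rewrite /= -{1}(subnKC ij) addSnnS expgnDr mulKg.
Qed.

End Components.

(** * Components of a manifold are neighbourhoods of their points *)

Section Manifold.
Variables (R : realType) (T : topologicalType) (d : nat) (a : chart R T d).
Hypothesis ca : is_chart a.

(** Points of a coordinate ball around [x] are joined to [x] by a path that is a straight segment in
    the chart. *)
Lemma chart_component_nbhs x : chart_dom a x -> nbhs x (connected_component [set: T] x).
Proof.
case: ca => odom oimg invK cfun cinv ax.
have ix : chart_img a (chart_fun a x) by exists x.
have /nbhs_ballP[e e0 eimg] : nbhs (chart_fun a x) (chart_img a) by exact: open_nbhs_nbhs.
have nx : nbhs x (chart_dom a `&` chart_fun a @^-1` ball (chart_fun a x) e).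
  apply: filterI; first exact: open_nbhs_nbhs.
  by apply: cfun => //; exact: nbhsx_ballx.
apply: filterS nx => y [ay ye].
pose c (t : R) := chart_fun a x + t *: (chart_fun a y - chart_fun a x).
pose gam t := chart_inv a (c t).
have cb t : t \in `[0, 1]%R -> ball (chart_fun a x) e (c t).
  rewrite in_itv /= => /andP[t0 t1]; move: ye; rewrite -!ball_normE /= => ye.
  rewrite /c opprD addNKr normrN normrZ ger0_norm// distrC.
  by rewrite (le_lt_trans _ ye)// ler_piMl.
exists (gam @` `[0, 1]).
  split=> //.
    by exists 0; rewrite /= ?in_itv /= ?lexx ?ler01// /gam /c scale0r addr0 invK.
  apply: connected_continuous_connected; first exact: segment_connected.
  apply: continuous_in_subspaceT => t; rewrite inE => t01.
  apply: continuous_comp.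
    apply: cvgD; first exact: cvg_cst.
    by apply: cvgZr_tmp; exact: cvg_id.
  by apply: cinv; apply: eimg; exact: cb.
by exists 1; rewrite /= ?in_itv /= ?lexx ?ler01// /gam /c scale1r addrC subrK invK.
Qed.

End Manifold.

Lemma Re_continuous (R : realType) : continuous (@complex.Re R).
Proof.
move=> z U /nbhs_ballP[e /= e0 eU]; apply/nbhs_ballP.
exists e%:C => /=; first by rewrite ltcR.
move=> w zw; apply: eU; rewrite -ball_normE /= -ltcR.
have -> : complex.Re z - complex.Re w = complex.Re (z - w).
  by case: (z) (w) => [? ?] [? ?].
by apply: le_lt_trans (normc_ge_Re (z - w)) _; move: zw; rewrite -ball_normE.
Qed.

Lemma sum_continuous (R : realType) (T : topologicalType) (I : finType)
    (F : I -> T -> R[i]) :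
  (forall i, continuous (F i)) -> continuous (fun x => \sum_i F i x).
Proof. by move=> Fc; apply: continuous_big => //; exact: add_continuous. Qed.

Lemma compact_bounded_complex (R : realType) (T : topologicalType) (f : T -> R[i]) :
  [set: T] !=set0 -> compact [set: T] -> continuous f ->
  exists M : R[i], forall x, `|f x| <= M.
Proof.
move=> T0 cT fc.
(* The modulus has values in [R[i]]; its real part is taken to apply the extreme value theorem over
   [R]. *)
have [|x _ xmax] := @compact_EVT_max _ R (fun x => complex.Re `|f x|) _ T0 cT.
  apply: continuous_subspaceT => x.
  apply: (@continuous_comp _ _ _ (fun x => `|f x|) (@complex.Re R)).
    by apply: cvg_norm; exact: fc.
  exact: Re_continuous.
exists (complex.Re `|f x|)%:C => y.
by have := xmax y (mem_set I); rewrite !normc_def lecR.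
Qed.

(** * Eigenvalues of a representation of a compact group *)

Section Representation.
Variables (R : realType) (G : topGroupType) (n : nat) (rho : G -> 'M[R[i]]_n).
Hypothesis hrho : is_representation rho.

Lemma repr1 : rho 1%g = 1%:M.
Proof.
have [_ runit rM _] := hrho.
by apply: (can_inj (mulKmx (runit 1%g))); rewrite -rM mulg1 mulmx1.
Qed.

Lemma repr_entry_continuous i j : continuous (fun g => rho g i j).
Proof.
have [_ _ _ rc] := hrho.
move=> g; apply: (@continuous_comp _ _ _ rho (fun M : 'M[R[i]]_n => M i j)).
  exact: rc.
exact: coord_continuous.
Qed.

Lemma repr_conj_entry_continuous (P Q : 'M[R[i]]_n) i j :
  continuous (fun g => (P *m rho g *m Q) i j).
Proof.
under eq_fun do rewrite mxE.
apply: sum_continuous => k.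
under eq_fun do rewrite mxE mulr_suml.
apply: sum_continuous => k' g.
apply: cvgM; last exact: cvg_cst.
by apply: cvgM; [exact: cvg_cst | exact: repr_entry_continuous].
Qed.

Lemma trace_continuous : continuous (fun g => complex.Re (\tr (rho g))).
Proof.
move=> g; apply: (@continuous_comp _ _ _ (fun g => \tr (rho g)) (@complex.Re R)).
  by move: g; apply: sum_continuous => i; exact: repr_entry_continuous.
exact: Re_continuous.
Qed.

(** The powers of an eigenvalue and of its inverse are diagonal entries of a fixed conjugate of
    [rho], bounded by compactness; so both have modulus at most 1, hence exactly 1. *)
Lemma repr_eigenvalues (g : G) : compact [set: G] ->
  exists l : 'I_n -> R[i], (forall j, `|l j| = 1) /\
    forall k, \tr (rho (g ^+ k)%g) = \sum_j l j ^+ k.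
Proof.
move=> cG; have [_ _ rM _] := hrho.
have rX h k : rho (h ^+ k.+1)%g = rho (h ^+ 1)%g *m rho (h ^+ k)%g.
  by rewrite -rM expg1 expgS.
have [||||||P [l [l' [Pu ll' lE l'E]]]] := @eigenvalues_powers R[i] n
    (fun k => rho (g ^+ k)%g) (fun k => rho (g^-1 ^+ k)%g).
- exact: repr1.
- exact: rX.
- exact: repr1.
- exact: rX.
- by rewrite /= !expg1 -rM mulgV repr1.
- by rewrite /= !expg1 -rM mulVg repr1.
have bnd i : exists M : R[i], forall h, `|(P *m rho h *m invmx P) i i| <= M.
  apply: compact_bounded_complex => //; first by exists 1%g.
  exact: repr_conj_entry_continuous.
exists l; split=> [i|k]; last first.
  under eq_bigr do rewrite -lE.
  by rewrite -[RHS]/(\tr _) mxtrace_mulC mulmxA mulVmx// mul1mx.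
have [M MP] := bnd i.
have l1 : `|l i| <= 1.
  by apply: (bounded_powers_le1 (@complex_archimedean R) (M := M)) => k; rewrite -lE.
have l'1 : `|l' i| <= 1.
  by apply: (bounded_powers_le1 (@complex_archimedean R) (M := M)) => k; rewrite -l'E.
apply/eqP; rewrite eq_le l1 /= -(normr1 R[i]) -(ll' i) normrM.
by rewrite ler_piMr.
Qed.

End Representation.

(** Some [g ^+ m.+1] lies in the identity component, so every [g ^+ (1 + m.+1 * k)] lies in the
    component of [g] and is subject to [gmax]. *)
Lemma extremal_trace_algebraic (R : realType) (G : topGroupType) (d : nat)
    (A : set (chart R G d)) (n : nat) (rho : G -> 'M[R[i]]_n) (x g : G) (s : R) :
  lie_group A -> compact [set: G] -> is_representation rho -> s != 0 ->
  connected_component [set: G] x g ->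
  (forall h, connected_component [set: G] x h ->
     s * complex.Re (\tr (rho h)) <= s * complex.Re (\tr (rho g))) ->
  algebraic_number (complex.Re (\tr (rho g)))%:C.
Proof.
move=> [[_ _ [Achart Acov _]] [mulc _] [invc _]] cG hrho s0 gx gmax.
have [a Aa a1] := Acov 1%g.
have [m gm] := expg_component1 mulc invc g cG (chart_component_nbhs (Achart a Aa) a1).
have [l [l1 lE]] := repr_eigenvalues hrho g cG.
have l1E : \tr (rho g) = \sum_j l j by rewrite -[g]expg1 lE.
rewrite l1E; apply: (algebraic_trace (m := m) l1 s0) => k.
rewrite -l1E -lE; apply: gmax; apply: connected_component_trans gx _.
rewrite expgnDr expg1 expgnA.
exact: component_expg.
Qed.

Theorem proposition17p1 (R : realType) (G : topGroupType) (d : nat)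
    (A : set (chart R G d)) (hG : lie_group A) (cG : compact [set: G])
    (n : nat) (rho : G -> 'M[R[i]]_n) (hrho : is_representation rho)
    (C : set G) (hC : is_component C) :
  exists vmin vmax : R,
    [/\ is_minimum [set complex.Re (\tr (rho g)) | g in C] vmin,
        is_maximum [set complex.Re (\tr (rho g)) | g in C] vmax,
        algebraic_number (vmin%:C)%C &
        algebraic_number (vmax%:C)%C].
Proof.
case: hC => x ->.
set f := fun g => complex.Re (\tr (rho g)).
have C0 : connected_component [set: G] x !=set0.
  by exists x; exact: connected_component_refl.
have Cc : compact (connected_component [set: G] x).
  by apply: subclosed_compact cG _ => //; apply: component_closed; exact: closedT.
have fc : {within connected_component [set: G] x, continuous f}.
  exact/continuous_subspaceT/trace_continuous.
have [gmin /set_mem Cmin gminP] := compact_EVT_min C0 Cc fc.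
have [gmax /set_mem Cmax gmaxP] := compact_EVT_max C0 Cc fc.
exists (f gmin), (f gmax); split.
- split; first by exists gmin.
  by move=> _ [h Ch <-]; apply: gminP; exact: mem_set.
- split; first by exists gmax.
  by move=> _ [h Ch <-]; apply: gmaxP; exact: mem_set.
- apply: (extremal_trace_algebraic (s := -1) hG cG hrho _ Cmin).
    by rewrite oppr_eq0 oner_eq0.
  by move=> h Ch; rewrite !mulN1r lerN2; apply: gminP; exact: mem_set.
- apply: (extremal_trace_algebraic (s := 1) hG cG hrho _ Cmax); first exact: oner_neq0.
  by move=> h Ch; rewrite !mul1r; apply: gmaxP; exact: mem_set.
Qed.
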